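(* Suppose $\operatorname{char}\mathcal{F}=p>0$ (so $\mathcal{F}=\mathbb{F}_q((\pi))$). (a) For every $x\in\mathcal{F}$ with $|x|_\mathfrak{p}>1$, the sequence $([x^n])_{n\ge1}$ is not $\mu$-uniformly distributed in $\mathcal{O}$. (b) For each positive integer $k$, for Haar-almost every $x\in\mathcal{F}$ with $|x|_\mathfrak{p}>1$, the subsequence $([x^n])_{n\ge1,\ p^k\parallel n}$ (indexed by those $n$ with $p^k\mid n$, $p^{k+1}\nmid n$) is $\mu_k$-uniformly distributed (in $\widetilde{\mathcal{S}_k}$). (c) For Haar-almost every $x\in\mathcal{F}$ with $|x|_\mathfrak{p}>1$, the sequence $([x^n])_{n\ge1}$ is $\mu^*$-uniformly distributed in $\mathcal{O}$.
   Context: $\mathcal{F}=\mathbb{F}_q((\pi))$ with valuation ring $\mathcal{O}=\mathbb{F}_q[[\pi]]$, normalized absolute value $|x|_\mathfrak{p}=q^{-v_\mathfrak{p}(x)}$; elements are written $x=\sum_{i\ge v_\mathfrak{p}(x)}c_i\pi^i$ with $c_i\in\mathbb{F}_q$, and $[x]=\sum_{i\ge0}c_i\pi^i$. $\mu$ is the Haar measure on $\mathcal{F}$ normalized by $\mu(\mathcal{O})=1$. For $k\ge1$, $\mathcal{S}_k=\{x=\sum c_i\pi^i\in\mathcal{F}: c_i=0\text{ whenever }p^k\nmid i\}$, $\widetilde{\mathcal{S}_k}=\mathcal{S}_k\cap\mathcal{O}$ (a closed additive subgroup of $\mathcal{O}$), and $\mu_k$ is the Haar measure of $\mathcal{S}_k$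 normalized by $\mu_k(\widetilde{\mathcal{S}_k})=1$, viewed also as a measure on $\mathcal{O}$ via $D\mapsto\mu_k(D\cap\widetilde{\mathcal{S}_k})$. Define the Borel probability measure $\mu^*$ on $\mathcal{O}$ by $\mu^*(D)=(1-\frac1p)\big(\mu(D)+\sum_{k\ge1}p^{-k}\mu_k(D\cap\widetilde{\mathcal{S}_k})\big)$ for disks $D\subset\mathcal{O}$. For a Borel probability measure $\nu$ on a compact space $X$, a sequence $(x_n)\subset X$ is $\nu$-uniformly distributed if $\frac1N\sum_{n=1}^N\delta_{x_n}\to\nu$ in the weak-* topology. *)

(* Defs.v *)
From HB Require Import structures.
From mathcomp Require Import all_boot all_order all_algebra.
From mathcomp Require Import all_classical all_reals all_analysis.
Set Implicit Arguments. Unset Strict Implicit. Unset Printing Implicit Defensive.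
Import Order.TTheory GRing.Theory Num.Theory.
Import numFieldNormedType.Exports.
Local Open Scope classical_set_scope.
Local Open Scope ring_scope.

(* The valuation ring O = F_q[[pi]] : an element sum_{i>=0} c_i pi^i is its  *)
(* coefficient sequence c : nat -> F.                                       *)
(* Otop F : O with its topology (product of discrete topologies on F,       *)
(*          i.e. the pi-adic topology).                                     *)
Notation Otop F := (prod_topology (fun _ : nat => discrete_topology F)).

Definition Opt (F : finFieldType) : Type := nat -> F.
HB.instance Definition _ (F : finFieldType) := Choice.copy (Opt F) (nat -> F).
HB.instance Definition _ (F : finFieldType) :=
  isPointed.Build (Opt F) (fun _ => 0).

Definition Omes (F : finFieldType) : measurableType _ :=
  @g_sigma_algebraType (Opt F) (@open (Otop F) : set (set (Opt F))).

(* The Laurent series field F((pi)).  [Laurent v a] denotes                  *)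
(* pi^v * sum_{i>=0} a_i pi^i  (v : int, a : nat -> F).                     *)
Record laurent (F : finFieldType) := Laurent { lval : int; lser : nat -> F }.

Section Laurent.
Variable F : finFieldType.

Definition lcoef (x : laurent F) (i : int) : F :=
  match (i - lval x)%R with Posz n => lser x n | Negz _ => 0 end.

Definition smul (a b : nat -> F) : nat -> F :=
  fun k => \sum_(i < k.+1) a i * b (k - i)%N.

Definition lmul (x y : laurent F) : laurent F :=
  Laurent (lval x + lval y) (smul (lser x) (lser y)).

Definition lone : laurent F := Laurent 0 (fun i => if i == 0%N then 1 else 0).

Definition lpow (x : laurent F) (n : nat) : laurent F := iter n (lmul x) lone.

Definition bracket (x : laurent F) : Omes F := fun i : nat => lcoef x (Posz i).

Definition is_val (x : laurent F) (v : int) : Prop :=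
  lcoef x v != 0 /\ forall j : int, (j < v)%R -> lcoef x j = 0.

(* |x|_p = q^(-v_p(x)) > 1, i.e. x <> 0 and v_p(x) < 0 (q > 1) *)
Definition pabs_gt1 (x : laurent F) : Prop :=
  exists v : int, is_val x v /\ (v < 0)%R.

(* the disk {y in O : |y - a| <= q^-r} = {y : y_i = a_i for i < r} *)
Definition disk (a : nat -> F) (r : nat) : set (Omes F) :=
  [set y : Omes F | forall i : nat, (i < r)%N -> y i = a i].

Definition Sk (p k : nat) : set (Omes F) :=
  [set y : Omes F | forall i : nat, ~~ (p ^ k %| i)%N -> y i = 0].

Variable R : realType.

(* nu is the normalized Haar measure of the closed subgroup S of O, viewed  *)
(* as a Borel probability measure on O: it is concentrated on S and         *)
(* invariant under translations by elements of S.                          *)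
Definition is_haar_on (S : set (Omes F)) (nu : probability (Omes F) R) : Prop :=
  nu S = 1%E /\
  forall s : Omes F, S s -> forall A : set (Omes F), measurable A ->
    nu [set ((fun i : nat => s i + a i) : Omes F) | a in A] = nu A.

Definition unif_distr (nu : probability (Omes F) R) (u : nat -> Omes F) : Prop :=
  forall f : Otop F -> R, continuous f ->
    (fun N : nat => (N.+1%:R)^-1 * \sum_(i < N.+1) f (u i))
      @ \oo --> Rintegral nu setT f.

(* "for Haar-almost every x in F((pi)), P x": for every m, the set of       *)
(* x in pi^m O violating P is Haar-null (charts a |-> pi^m a from O).      *)
Definition haar_ae (mu : probability (Omes F) R) (P : laurent F -> Prop) : Prop :=
  forall m : int, {ae mu, forall a : Omes F, P (Laurent m a)}.

End Laurent.

(* Main.v *)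
Require Import Defs.
From HB Require Import structures.
From mathcomp Require Import all_boot all_order all_algebra.
From mathcomp Require Import all_classical all_reals all_analysis.
Import Order.TTheory GRing.Theory Num.Theory.
Import numFieldNormedType.Exports.
From mathcomp Require Import ring lra zify.
Set Implicit Arguments.
Unset Strict Implicit.
Unset Printing Implicit Defensive.
Local Open Scope classical_set_scope.
Local Open Scope ring_scope.

(* Let v(x) = -w < 0 and write x = pi^(-w) b with b_0 <> 0.  For n prime to p the coefficient of
   pi^i in x^n is n b_0^(n-1) b_(nw+i) plus a function of b_0, ..., b_(nw+i-1).  Hence, given the
   first nw coefficients of b, the first r coefficients of [x^n] are exactly uniform, and the
   centred indicators of a cylinder for n and n' are orthogonal as soon as n' >= n + r.  The variance
   of the partial sums is therefore O(N); Chebyshev and Borel-Cantelli along the squares give the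
   mu-equidistribution of ([x^n])_(p not dividing n) for almost every x.  The iterated Frobenius
   [x^(p^k m)] = stretch k [x^m] carries mu to mu_k, which settles the exponents with p^k || n,
   and the exponents divisible by p^K have density p^-K, which permits summation over k.
   The failure of mu-equidistribution is visible on the coefficients of index 1 and p + 1: they
   both vanish for all n divisible by p, a set of density 1/p > 1/q^2. *)

(** * The topology of O in terms of disks *)

Section CylinderTopology.
Variable F : finFieldType.
Implicit Types (y z : Otop F) (r : nat).

Lemma nbhs_coord y r : nbhs y [set z : Otop F | z r = y r].
Proof.
have H := @proj_continuous _ (fun _ : nat => discrete_topology F) r y.
have := H [set y r] (discrete_set1 (y r : discrete_topology F)).
by rewrite nbhs_simpl.
Qed.

Lemma nbhs_disk y r : nbhs y (disk y r : set (Otop F)).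
Proof.
have FF : Filter (nbhs y) := nbhs_filter y.
elim: r => [|r IH].
  have -> : disk y 0 = [set: Otop F] by apply/seteqP; split.
  exact: (@filterT _ _ FF).
apply: (@filterS _ _ FF _ _ _ (@filterI _ _ FF _ _ IH (nbhs_coord y r))) => z [Hz zr] i.
by rewrite ltnS leq_eqVlt => /orP[/eqP->//|/Hz].
Qed.

(** Otherwise every disk around [y] contains a point outside [U]. These points agree with [y] on
    ever longer prefixes, so they converge to [y] in the product topology and must enter [U]. *)
Lemma nbhs_subdisk y (U : set (Otop F)) :
  nbhs (y : Otop F) U -> exists r, disk y r `<=` U.
Proof.
move=> nU; apply: contrapT => /forallNP H.
have /choice[g Hg] : forall r, exists z, disk y r z /\ ~ U z.
  by move=> r; move: (H r) => /existsNP[z /not_implyP]; exists z.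
have gy : (g : nat -> Otop F) @ \oo --> (y : Otop F).
  apply/cvg_sup => N V [W] [[X] oX <-] XyN WV.
  apply: (filterS WV); rewrite nbhs_simpl; exists N.+1 => // i /= Ni.
  by have [->] := Hg i.
have /= [N _ gN] := gy _ nU.
by have [_] := Hg N; apply; apply: (gN N) => /=.
Qed.

Lemma open_diskP (U : set (Otop F)) :
  open U <-> forall y, U y -> exists r, disk y r `<=` U.
Proof.
split=> [oU y Uy|H]; first exact/nbhs_subdisk/open_nbhs_nbhs.
rewrite openE => y /H[r]; rewrite /interior/=.
  move=> rU; exact: (@filterS _ (nbhs (y : Otop F)) (nbhs_filter _) _ _ rU (nbhs_disk y r)).
Qed.

Lemma compact_O : compact [set: Otop F].
Proof.
have cF : compact [set: discrete_topology F].
  exact/finite_compact/(@finite_finset F).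
have := @tychonoff nat (fun=> discrete_topology F) (fun=> setT) (fun=> cF).
by congr (compact _); apply/seteqP.
Qed.

(** Uniform continuity from compactness in its near-covering form: a local radius for [e / 2] serves
    all points of the disk, by the triangle inequality through the centre. *)
Lemma continuous_unif_disk (R : realType) (f : Otop F -> R) (e : R) :
  continuous f -> 0 < e ->
  exists r, forall y z, disk y r z -> `|f y - f z| < e.
Proof.
move=> cf e0; have e2 : 0 < e / 2 by rewrite divr_gt0.
have H (y : Otop F) : exists r, forall z, disk y r z -> `|f y - f z| < e / 2.
  have /cvgrPdist_lt/(_ _ e2)/nbhs_subdisk[r Hr] := cf y.
  by exists r => z /Hr.
have /compact_near_coveringP/(_ nat \oo
    (fun N (y : Otop F) => forall z, disk y N z -> `|f y - f z| < e)) [] := compact_O.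
  move=> y _; have [r Hr] := H y.
  exists (disk y r, [set N | (r <= N)%N]) => /=.
    by split; [exact: nbhs_disk | exists r].
  move=> [y' N] /= [y'r rN] z zN; rewrite (splitr e).
  apply: le_lt_trans (ler_distD (f y) _ _) _; apply: ltrD.
    by rewrite distrC; exact: Hr.
  by apply: Hr => i ir; rewrite (zN i (leq_trans ir rN)) y'r.
by move=> N _ HN; exists N => y z; apply: (HN N) => /=.
Qed.

End CylinderTopology.

(** * Words, cylinders and measurability *)

Notation word F r := {ffun 'I_r -> F}.

Lemma cvg_sumr (R : realType) (I : finType) (f : I -> nat -> R) (l : I -> R) :
  (forall i, f i n @[n --> \oo] --> l i) ->
  (\sum_i f i n) @[n --> \oo] --> \sum_i l i.
Proof.
move=> H; elim: (index_enum I) => [|i s IH].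
  rewrite big_nil (_ : (fun n => _) = cst 0); first exact: cvg_cst.
  by apply/funext => n; rewrite big_nil.
rewrite big_cons (_ : (fun n => _) = f i \+ fun n => \sum_(i <- s) f i n).
  by apply: cvgD.
by apply/funext => n; rewrite big_cons.
Qed.

Section Cylinders.
Variable F : finFieldType.
Implicit Types (y z : nat -> F) (r : nat).

Definition restr r y : word F r := [ffun i : 'I_r => y i].

(** Right inverse of [restr]: padding by 0 evaluates functions of sequences on words. *)
Definition ext r (w : word F r) : nat -> F :=
  fun i => if insub i is Some j then w j else 0.

Lemma extK r : cancel (@ext r) (@restr r).
Proof. by move=> w; apply/ffunP => i; rewrite ffunE /ext valK. Qed.

Lemma eq_restr r y z :
  (forall i, (i < r)%N -> y i = z i) <-> restr r y = restr r z.
Proof.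
split=> [yz|/ffunP yz i ir]; first by apply/ffunP => i; rewrite !ffunE yz.
by have := yz (Ordinal ir); rewrite !ffunE.
Qed.

Lemma ext_restr r y i : (i < r)%N -> ext (restr r y) i = y i.
Proof. by apply/eq_restr : i; rewrite extK. Qed.

Definition cylinder r (B : {set word F r}) : set (Omes F) :=
  [set y | restr r y \in B].

Lemma diskE y r : disk y r = cylinder [set restr r y].
Proof.
apply/seteqP; split=> z; rewrite /cylinder/= inE.
  by move=> /eq_restr/eqP.
by move=> /eqP/eq_restr.
Qed.

Lemma open_measurable_O (U : set (Omes F)) :
  (forall y, U y -> exists r, disk y r `<=` U) -> measurable U.
Proof. by move=> H; apply: sub_sigma_algebra; apply/open_diskP. Qed.

Lemma measurable_cylinder r (B : {set word F r}) : measurable (cylinder B).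
Proof.
apply: open_measurable_O => y yB; exists r => z /eq_restr.
by rewrite /cylinder/= => ->.
Qed.

(** The hypothesis is continuity expressed by disks, so preimages of open sets are open, and these
    generate the Borel sets. *)
Lemma measurable_fun_O (h : Omes F -> Omes F) :
  (forall y r, exists r', forall z, disk y r' z -> disk (h y) r (h z)) ->
  measurable_fun setT h.
Proof.
move=> H; apply: (@measurability _ _ (Omes F) (Omes F) setT h (@open (Otop F) : set (set (Opt F)))); first by [].
move=> _ [U oU <-]; rewrite setTI; apply: open_measurable_O => y Uhy.
have /open_diskP/(_ _ Uhy)[r rU] := oU.
have [r' Hr'] := H y r.
by exists r' => z /Hr'/rU.
Qed.

Lemma measurable_Sk p k : measurable (@Sk F p k).
Proof.
(* The complement is open: a nonzero coefficient at a forbidden index persists on a disk. *)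
rewrite -[X in measurable X]setCK; apply: (@measurableC _ (Omes F)).
apply: open_measurable_O => y.
move=> /existsNP[i /not_implyP[pi yi]]; exists i.+1 => z zy /(_ i pi).
by rewrite zy.
Qed.

End Cylinders.

(** * Probabilities of cylinders and a Weyl criterion *)

Section CylinderMeasure.
Variables (R : realType) (F : finFieldType) (nu : probability (Omes F) R).

Definition pr r (B : {set word F r}) : R := fine (nu (cylinder B)).

Lemma prE r (B : {set word F r}) : nu (cylinder B) = (pr B)%:E.
Proof. by rewrite fineK// fin_num_measure//; exact: measurable_cylinder. Qed.

Lemma Rintegral_word r (c : word F r -> R) :
  \int[nu]_(y in setT) c (restr r y) = \sum_w c w * pr [set w].
Proof.
pose f w y : \bar R := ((c w)%:E * (\1_(cylinder [set w]) y)%:E)%E.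
have fint w : nu.-integrable setT (f w).
  apply: integrableZl => //; apply: integrable_indic; exact: measurable_cylinder.
rewrite /Rintegral (_ : (\int[nu]_(y in _) _)%E =
    \int[nu]_(y in setT) (\sum_w f w y))%E; last first.
  apply: eq_integral => y _; rewrite (bigD1 (restr r y))//= big1 ?addr0.
    by rewrite /f indicE mem_set ?mule1// /cylinder /= inE.
  move=> w wy; rewrite /f indicE memNset ?mule0//.
  by rewrite /cylinder /= inE eq_sym; exact/negP.
rewrite integral_sum//.
rewrite (eq_bigr (fun w => (c w * pr [set w])%:E)) ?sumEFin// => w _.
rewrite integralZl//; last by apply: integrable_indic; exact: measurable_cylinder.
rewrite integral_indic//; last exact: measurable_cylinder.
by rewrite setIT EFinM -prE.
Qed.

Lemma pr_sum r (B : {set word F r}) : pr B = \sum_(w in B) pr [set w].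
Proof.
transitivity (\int[nu]_(y in setT) ((restr r y \in B)%:R : R)).
  rewrite /pr /Rintegral; congr fine.
  rewrite -[in LHS](setIT (cylinder B)) -integral_indic//; last exact: measurable_cylinder.
  apply: eq_integral => y _; rewrite indicE; congr ((nat_of_bool _)%:R%:E).
  by apply/idP/idP => [/set_mem//|yB]; rewrite mem_set.
rewrite (Rintegral_word (fun w => (w \in B)%:R)) [RHS]big_mkcond/=.
by apply: eq_bigr => w _; case: ifP; rewrite ?mul1r ?mul0r.
Qed.

Lemma pr_setT r : pr [set: word F r] = 1.
Proof.
rewrite /pr (_ : cylinder _ = setT) ?probability_setT//.
by apply/seteqP; split=> // y _; rewrite /cylinder /= inE.
Qed.

Lemma measurable_fun_continuous (f : Otop F -> R) :
  continuous f -> measurable_fun (setT : set (Omes F)) (f : Omes F -> R).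
Proof.
move=> /continuousP cf.
apply: (measurability _ (measurable_realfun.RGenOpens.measurableE R)).
move=> _ [_ [a [b ->] <-]]; rewrite setTI.
by apply: sub_sigma_algebra; apply/cf/interval_open.
Qed.

(** Continuous functions are uniform limits of functions of finitely many coefficients, so it
    suffices that the frequency of each word converges. *)
Lemma unif_distr_word (u : nat -> Omes F) :
  (forall r (w : word F r),
    (fun N : nat => (N.+1%:R)^-1 * \sum_(i < N.+1) (restr r (u i) \in [set w]%SET)%:R : R)
      @ \oo --> pr [set w]) ->
  unif_distr nu u.
Proof.
move=> H f cf; apply/cvgrPdist_le => e e0.
have e3 : 0 < e / 3%:R by rewrite divr_gt0.
have [r Hr] := continuous_unif_disk cf e3.
pose c (w : word F r) : R := f (ext w : Otop F).
have fc y : `|f y - c (restr r y)| <= e / 3%:R.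
  by apply/ltW/Hr => i ir; rewrite ext_restr.
have fint : nu.-integrable setT (EFin \o (f : Omes F -> R)).
  apply: measurable_bounded_integrable => //.
  - exact: le_lt_trans (probability_le1 nu (@measurableT _ (Omes F))) (ltry 1).
  - exact: measurable_fun_continuous.
  - exists (\sum_w `|c w| + e / 3%:R); split; first by rewrite num_real.
    move=> M /ltW HM y _; apply: le_trans HM.
    rewrite -[f y](subrK (c (restr r y))) addrC.
    apply: le_trans (ler_normD _ _) _; apply: lerD => //.
    by rewrite (bigD1 (restr r y))//= lerDl sumr_ge0.
have cint : nu.-integrable setT (EFin \o (fun y => c (restr r y))).
  apply: measurable_bounded_integrable => //.
  - exact: le_lt_trans (probability_le1 nu (@measurableT _ (Omes F))) (ltry 1).
  - apply: (measurable_fun_continuous (f := fun y : Otop F => c (restr r y))) => y.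
    apply: (@cvg_near_cst (Otop F) R (c (restr r y)) (fun z => c (restr r z))
      (nbhs (y : Otop F)) (nbhs_filter _)).
    apply: (@filterS _ _ (nbhs_filter _) _ _ _ (nbhs_disk (y : Otop F) r)) => z.
    by move=> /eq_restr /= ->.
  - exists (\sum_w `|c w|); split; first by rewrite num_real.
    move=> M /ltW HM y _; apply: le_trans HM.
    by rewrite (bigD1 (restr r y))//= lerDl sumr_ge0.
have If : `|Rintegral nu setT f - \sum_w c w * pr [set w]| <= e / 3%:R.
  rewrite -Rintegral_word -RintegralB//.
  apply: le_trans (le_normr_Rintegral _ _) _ => //.
    by move: (integrableB measurableT fint cint).
  apply: le_trans (_ : \int[nu]_(y in setT) (e / 3%:R) <= _); last first.
    rewrite Rintegral_cst// -[leRHS]mulr1 -[X in _ <= _ * X]/(fine 1%:E).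
    rewrite -(probability_setT nu); exact: lexx.
  apply: le_Rintegral => //.
  - have H1 := integrableB measurableT fint cint.
    exact: (integrable_norm (f := fun y : Omes F => f y - c (restr r y)) H1).
  - exact: finite_measure_integrable_cst.
have Hc : (fun N : nat => (N.+1%:R)^-1 * \sum_(i < N.+1) c (restr r (u i)))
    @ \oo --> \sum_w c w * pr [set w].
  rewrite (_ : (fun N => _) = (fun N : nat => \sum_w c w *
    ((N.+1%:R)^-1 * \sum_(i < N.+1) (restr r (u i) \in [set w]%SET)%:R))); last first.
    apply/funext => N.
    under [RHS]eq_bigr do rewrite mulrCA mulr_sumr.
    rewrite -mulr_sumr exchange_big/=; congr (_ * _); apply: eq_bigr => i _.
    rewrite (bigD1 (restr r (u i)))//= finset.set11 mulr1 big1 ?addr0// => w wi.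
    by rewrite finset.in_set1 eq_sym (negbTE wi) mulr0.
  by apply: cvg_sumr => w; apply: cvgMl_tmp; exact: H.
move/cvgrPdist_le : Hc => /(_ _ e3); apply: filterS => N HN.
rewrite (_ : e = e / 3%:R + e / 3%:R + e / 3%:R); last by field.
set cN := _ * _ in HN.
(* Three errors: replacing [f] by [c] in the integral, the word frequencies, and replacing [f] by
   [c] in the average. *)
rewrite -[Rintegral _ _ _](subrK (\sum_w c w * pr [set w])).
rewrite -addrA -[X in _ + X](subrKA cN) addrA.
apply: le_trans (ler_normD _ _) _; apply: lerD.
  by apply: le_trans (ler_normD _ _) _; exact: lerD.
rewrite -mulrBr -sumrB normrM ger0_norm; last by rewrite invr_ge0.
rewrite ler_pdivrMl ?ltr0Sn//.
apply: le_trans (ler_norm_sum _ _ _) _.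
rewrite mulr_natl -[X in _ *+ X]card_ord -sumr_const.
by apply: ler_sum => i _; rewrite distrC.
Qed.

End CylinderMeasure.

(** * Haar measures of subgroups of O on cylinders *)

Section HaarCylinder.
Variables (R : realType) (F : finFieldType).
Local Notation q := #|F|.

Definition translate (s : Omes F) (A : set (Omes F)) : set (Omes F) :=
  [set ((fun i : nat => s i + a i) : Omes F) | a in A].

Lemma translate_cylinder (t t' : Omes F) r :
  translate (fun i => t' i - t i) (cylinder [set restr r t]) =
  cylinder [set restr r t'].
Proof.
rewrite -!diskE; apply/seteqP; split=> z.
  by move=> [a at_ <-] i ir; rewrite at_// subrK.
move=> zt'; exists (fun i => z i - (t' i - t i)).
  by move=> i ir; rewrite zt'// subKr.
by apply/funext => i; rewrite addrC subrK.
Qed.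

(** Cylinders that meet [S] are translates of one another by elements of [S], hence have equal mass;
    the others lie in the complement of [S] and are null. Total mass 1 fixes the common value. *)
Lemma haar_pr_word (S : set (Omes F)) (nu : probability (Omes F) R) :
  measurable S -> (forall s t, S s -> S t -> S (fun i => t i - s i)) ->
  is_haar_on S nu -> forall r (w : word F r),
  let P := [set v : word F r | `[< exists2 s, S s & restr r s = v >]]%SET in
  pr nu [set w] = if w \in P then #|P|%:R^-1 else 0.
Proof.
move=> mS subS [nuS Hnu] r w P.
have nP v : v \notin P -> pr nu [set v] = 0.
  rewrite inE => /asboolP vP.
  rewrite /pr (_ : nu _ = 0%E)//; apply/eqP; rewrite -measure_le0.
  apply: (@le_trans _ _ (nu (~` S))).
    apply: le_measure; rewrite ?inE.
    - exact: measurable_cylinder.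
    - exact: (@measurableC _ (Omes F)).
    - move=> y; rewrite /cylinder/= inE => /eqP yv Sy.
      by apply: vP; exists y.
  by rewrite probability_setC// [X in (_ - X)%E]nuS subee.
have eP v : v \in P -> w \in P -> pr nu [set v] = pr nu [set w].
  rewrite inE => /asboolP[s Ss <-]; rewrite inE => /asboolP[t St <-].
  rewrite /pr -(translate_cylinder t s) /translate Hnu//; first exact: subS.
  exact: measurable_cylinder.
case: ifPn => [wP|/nP//].
have : \sum_(v in P) pr nu [set v] = 1.
  rewrite -(pr_setT nu r) [RHS]pr_sum [RHS](bigID (mem P))/=.
  rewrite [X in _ = _ + X]big1 => [|v /andP[_ /nP]//]; rewrite addr0.
  by apply: eq_bigl => v; rewrite finset.in_setT.
rewrite (eq_bigr (fun=> pr nu [set w])) => [|v vP]; last exact: eP.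
rewrite sumr_const => H; apply/esym/mulr1_eq.
by rewrite mulr_natl.
Qed.

(** The values in [haar_pr_word] depend on [S] only. This later identifies mu_k with an image of
    mu. *)
Lemma haar_pr_unique (S : set (Omes F)) (nu nu' : probability (Omes F) R) :
  measurable S -> (forall s t, S s -> S t -> S (fun i => t i - s i)) ->
  is_haar_on S nu -> is_haar_on S nu' ->
  forall r (B : {set word F r}), pr nu B = pr nu' B.
Proof.
move=> mS subS Hn Hn' r B; rewrite (pr_sum nu) (pr_sum nu').
by apply: eq_bigr => w _; rewrite (haar_pr_word mS subS Hn) (haar_pr_word mS subS Hn').
Qed.

Lemma haar_pr (mu : probability (Omes F) R) : is_haar_on [set: Omes F] mu ->
  forall r (B : {set word F r}), pr mu B = #|B|%:R / (q ^ r)%:R.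
Proof.
move=> hmu r B; rewrite pr_sum.
rewrite (eq_bigr (fun=> (q ^ r)%:R^-1)).
  by rewrite sumr_const mulr_natl.
move=> w _; rewrite (haar_pr_word _ _ hmu)//.
set P := finset _; have -> : P = [set: word F r]%SET.
  by apply/setP => v; rewrite !inE; apply/asboolP; exists (ext v); rewrite ?extK.
by rewrite inE cardsT card_ffun card_ord.
Qed.

(** Additivity of [h] turns translation by [h s'] on the target into translation by [s'] on the
    source. *)
Lemma pushforward_haar (mu : probability (Omes F) R)
    (h : {mfun Omes F >-> Omes F}) :
  is_haar_on [set: Omes F] mu ->
  (forall a b, h (fun i => a i + b i) = fun i => h a i + h b i) ->
  is_haar_on (range h) (distribution mu h).
Proof.
move=> [mu1 Hmu] hD; split.
  rewrite -[RHS]mu1; congr (mu _); apply/seteqP; split=> // y _.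
  by exists y.
move=> s [s' _ <-] A mA; rewrite /distribution /pushforward/=.
have mhA : measurable (h @^-1` A).
  by rewrite -[X in measurable X]setTI; exact: measurable_funP.
rewrite -[RHS](Hmu s' I _ mhA); congr (mu _); apply/seteqP; split=> b /=.
  move=> [a Aa ab]; exists (fun i => b i - s' i).
    rewrite /= (_ : h _ = a)//; apply/funext => i.
    have /(congr1 (fun f => f i)) /= : h (fun i => s' i + (b i - s' i)) = h b.
      by congr (h _); apply/funext => j; rewrite addrC subrK.
    by rewrite hD -ab => /addrI.
  by apply/funext => j; rewrite addrC subrK.
by move=> [a /= Aa <-]; exists (h a) => //; rewrite hD.
Qed.

End HaarCylinder.

(** * Powers of power series and of Laurent series *)

Section PowerSeries.
Variable F : finFieldType.
Implicit Types (a b y : nat -> F).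

Definition spow a n : nat -> F := iter n (smul a) (lser (lone F)).

Lemma lpowE m a n : lpow (Laurent m a) n = Laurent (m *+ n) (spow a n).
Proof. by elim: n => //= n ->; rewrite /lmul/= mulrS. Qed.

Definition trunc L a : {poly F} := \poly_(i < L) a i.

(** Coefficients below [L] of a product involve only coefficients below [L] of its factors, so
    powers can be computed in [{poly F}]. *)
Lemma coef_spow a n L k : (k < L)%N -> spow a n k = (trunc L a ^+ n)`_k.
Proof.
elim: n k => [|n IH] k kL; first by rewrite expr0 coef1 /spow /=; case: eqP.
rewrite exprS coefM /=; apply: eq_bigr => i _.
rewrite -/(spow a n) IH; last exact: leq_ltn_trans (leq_subr _ _) kL.
by rewrite coef_poly (leq_ltn_trans _ kL) // -ltnS.
Qed.

Lemma eq_spow a b n k :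
  (forall i, (i <= k)%N -> a i = b i) -> spow a n k = spow b n k.
Proof.
move=> ab; rewrite !(@coef_spow _ _ k.+1)// (_ : trunc _ a = trunc k.+1 b)//.
by apply/polyP => i; rewrite !coef_poly; case: ltnP => // /ab.
Qed.

(* the coefficient of index j of b^n is n b_0^(n-1) b_j plus a function of b_0, ..., b_(j-1) *)
Lemma spow_triangular b b' n j : (0 < j)%N -> n%:R != 0 :> F -> b 0%N != 0 ->
  (forall i, (i < j)%N -> b i = b' i) -> spow b n j = spow b' n j -> b j = b' j.
Proof.
move=> j0 n0 b0 bb'; rewrite !(@coef_spow _ _ j.+1)// => /eqP.
(* The difference of the powers factors: the difference of the truncations is a monomial of degree
   [j], and the cofactor has constant term n b_0^(n-1), which is nonzero. *)
rewrite -subr_eq0 -coefB subrXX.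
have -> : trunc j.+1 b - trunc j.+1 b' = 'X^j * (b j - b' j)%:P.
  apply/polyP => i; rewrite coefB !coef_poly coefXnM coefC subn_eq0.
  by rewrite ltnS; case: (ltngtP i j) => [/bb' ->|_|->]; rewrite ?subrr ?subr0.
rewrite -mulrA coefXnM ltnn subnn coefCM mulf_eq0 subr_eq0 => /orP[/eqP//|].
rewrite -horner_coef0 horner_sum (eq_bigr (fun=> b 0%N ^+ n.-1)).
  rewrite sumr_const card_ord -mulr_natl mulf_eq0 (negbTE n0)/=.
  by rewrite expf_eq0 (negbTE b0) andbF.
move=> i _; rewrite hornerM !horner_exp !horner_coef0 !coef_poly/= -(bb' 0%N j0).
by rewrite -exprD; congr (_ ^+ _); have := ltn_ord i; lia.
Qed.

Definition shift d y : nat -> F := fun i => y (d + i)%N.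

Lemma spow_shift a d n j : (forall i, (i < d)%N -> a i = 0) ->
  spow a n j = if (j < d * n)%N then 0 else spow (shift d a) n (j - d * n).
Proof.
move=> a0; rewrite (@coef_spow _ _ (d + j.+1))//; last lia.
have -> : trunc (d + j.+1) a = 'X^d * trunc j.+1 (shift d a).
  apply/polyP => i; rewrite coefXnM !coef_poly; case: (ltnP i d) => id.
    by rewrite a0// if_same.
  rewrite /shift subnKC//.
  by have -> : (i < d + j.+1)%N = (i - d < j.+1)%N by lia.
rewrite exprMn -exprM coefXnM; case: ltnP => // _.
by rewrite -coef_spow//; lia.
Qed.

Lemma match_int_neg (z : int) (f : nat -> F) :
  (z < 0)%R -> match z with Posz n => f n | Negz _ => 0 end = 0.
Proof. by case: z. Qed.

(** Both pairs denote the same Laurent series; this normalises the leading coefficient to be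
    nonzero. *)
Lemma bracket_shift m a d n : (forall i, (i < d)%N -> a i = 0) ->
  bracket (lpow (Laurent m a) n) =
  bracket (lpow (Laurent (m + d%:Z) (shift d a)) n).
Proof.
move=> a0; apply/funext => i; rewrite !lpowE /bracket /lcoef/= mulrnDl.
have -> : (i%:Z - (m *+ n + d%:Z *+ n) = i%:Z - m *+ n - (d * n)%:Z)%R.
  by rewrite opprD addrA -[d%:Z *+ n]mulr_natr natz PoszM.
case: (i%:Z - m *+ n)%R => j.
  rewrite (spow_shift _ _ a0); case: ltnP => jd; last by rewrite subzn.
  by rewrite match_int_neg//; lia.
by rewrite match_int_neg//; lia.
Qed.

Lemma bracket_neg w b n i :
  bracket (lpow (Laurent (- w%:Z) b) n) i = spow b n (n * w + i).
Proof.
rewrite lpowE /bracket /lcoef/= (_ : _ - _ = (n * w + i)%:Z)//.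
by rewrite mulNrn opprK -mulr_natr natz PoszD PoszM addrC [in RHS]mulrC.
Qed.

(** * The iterated Frobenius on series *)

Variable p : nat.
Hypothesis hp : p \in [pchar F].

Let p_pr : prime p := pcharf_prime hp.

Lemma exprDF (K : comNzRingType) (x y : K) k : p \in [pchar K] ->
  (x + y) ^+ (p ^ k) = x ^+ (p ^ k) + y ^+ (p ^ k).
Proof.
move=> pK; apply: exprDn_pchar.
by rewrite pnatX (eq_pnat _ (pcharf_eq pK)) pnat_id ?p_pr.
Qed.

(** Induction along [Q * 'X + c], the p^k-th power being additive in characteristic p. *)
Lemma coef_exprF (Q : {poly F}) k j :
  (Q ^+ (p ^ k))`_j = if (p ^ k %| j)%N then Q`_(j %/ p ^ k) ^+ (p ^ k) else 0.
Proof.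
have pk0 : (0 < p ^ k)%N by rewrite expn_gt0 prime_gt0.
have z0 : 0 ^+ (p ^ k) = 0 :> F by rewrite expr0n eqn0Ngt pk0.
elim/poly_ind: Q j => [|Q c IH] j.
  by rewrite expr0n eqn0Ngt pk0 !coef0 z0 if_same.
rewrite exprDF; last by rewrite pchar_poly.
rewrite exprMn coefD coefMXn -polyC_exp coefC IH coefD coefMX coefC.
case: ltnP => jp.
  have [->|j0] := eqVneq j 0%N; first by rewrite dvdn0 div0n eqxx !add0r.
  by rewrite gtnNdvd ?lt0n// addr0.
have j0 : j != 0%N by rewrite -lt0n; exact: leq_trans jp.
rewrite (negbTE j0) addr0 dvdn_subl//; case: ifP => // pj.
have d0 : (j %/ p ^ k == 0)%N = false.
  by apply/negbTE; rewrite -lt0n divn_gt0.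
rewrite d0 addr0 -[in RHS](subnK jp) divnDr// divnn pk0 addn1/=.
by [].
Qed.

(** The coefficients of y^(p^k), where F has characteristic p. *)
Definition stretch k y : nat -> F :=
  fun i => if (p ^ k %| i)%N then y (i %/ p ^ k)%N ^+ (p ^ k) else 0.

Lemma spowF a k n j : spow a (p ^ k * n) j = stretch k (spow a n) j.
Proof.
rewrite (@coef_spow _ _ j.+1)// mulnC exprM coef_exprF /stretch.
by case: ifP => // _; rewrite -coef_spow// ltnS leq_div.
Qed.

(** The p^k-th power multiplies exponents of pi by p^k and preserves their signs, so it commutes
    with taking the integral part. *)
Lemma bracketF x k n :
  bracket (lpow x (p ^ k * n)) = stretch k (bracket (lpow x n)).
Proof.
have pk0 : (0 < p ^ k)%N by rewrite expn_gt0 prime_gt0.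
have z0 : 0 ^+ (p ^ k) = 0 :> F by rewrite expr0n eqn0Ngt pk0.
case: x => m a; apply/funext => i; rewrite /stretch !lpowE /bracket /lcoef/=.
rewrite mulnC mulrnA; set M := m *+ n.
case: ifP => [/dvdnP[i' ->]|pi].
  rewrite mulnK//.
  have -> : ((i' * p ^ k)%N%:Z - M *+ (p ^ k) = (i'%:Z - M) * (p ^ k)%:Z)%R.
    by rewrite PoszM mulrBl -[M *+ _]mulr_natr natz.
  case: (i'%:Z - M)%R => j; last first.
    by rewrite z0 match_int_neg// nmulr_rlt0.
  by rewrite -PoszM mulnC [in LHS]mulnC mulnC spowF /stretch dvdn_mull// mulnK.
(* Here p^k does not divide [i], hence not the index j = i - p^k M either. *)
case E : (_ - _)%R => [j|//]; rewrite mulnC spowF /stretch ifN//.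
apply: contraFN pi => /dvdnP[j' jE]; move: E; rewrite {}jE => E.
suff : ((p ^ k)%N%:Z %| i%:Z)%Z by [].
have -> : i%:Z = ((j'%:Z + M) * (p ^ k)%:Z)%R.
  by rewrite mulrDl -PoszM -E mulrC -[M *+ _]mulr_natr natz; ring.
exact: dvdz_mull.
Qed.

Lemma stretchD k a b :
  stretch k (fun i => a i + b i) = fun i => stretch k a i + stretch k b i.
Proof.
by apply/funext => i; rewrite /stretch; case: ifP; rewrite ?addr0// exprDF.
Qed.

(** Frobenius is injective on a field, and F is finite. *)
Lemma expF_surj k (c : F) : exists x : F, x ^+ (p ^ k) = c.
Proof.
have inj : injective (fun x : F => x ^+ (p ^ k)).
  move=> x y /= xy; apply/eqP; rewrite -subr_eq0; apply/eqP.
  have := exprDF (x - y) y k hp; rewrite subrK xy => /esym/eqP.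
  by rewrite -subr_eq0 addrK expf_eq0 => /andP[_ /eqP].
by exists (invF inj c); exact: (f_invF inj).
Qed.

Lemma range_stretch k : range (stretch k : Omes F -> Omes F) = Sk p k.
Proof.
have pk0 : (0 < p ^ k)%N by rewrite expn_gt0 prime_gt0.
apply/seteqP; split=> [_ [y _ <-] i pi|z zS]; first by rewrite /stretch ifN.
have [g Hg] := choice (expF_surj k).
exists (fun i => g (z (i * p ^ k)%N)) => //; apply/funext => i; rewrite /stretch.
by case: ifPn => [pi|/zS//]; rewrite Hg divnK.
Qed.

End PowerSeries.

(** * Orthogonality of the centred indicators and the variance of their sums *)

Section Orthogonality.
Variables (R : realType) (F : finFieldType) (p : nat).
Hypothesis hp : p \in [pchar F].
Variables (w r : nat) (B : {set word F r}).
Hypothesis w0 : (0 < w)%N.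
Implicit Types (b : nat -> F) (n J L : nat).
Local Notation q := #|F|.

(** For x = pi^(-w) b, the word of the first [r] coefficients of [x^n]; see [bracket_neg]. *)
Definition window n b : word F r := [ffun i : 'I_r => spow b n (n * w + i)].

Definition density : R := #|B|%:R / (q ^ r)%:R.

(* centred at the conditional mean of the indicator given the first [n * w] coefficients of [b] *)
Definition fluct n b : R :=
  if (b 0%N != 0) && ~~ (p %| n)%N then (window n b \in B)%:R - density else 0.

(** Added to [b], it changes only the block of [r] coefficients from [J] on. *)
Definition put J (e : word F r) : nat -> F :=
  fun i => if (J <= i)%N then ext e (i - J) else 0.

Lemma q_gt0 k : 0 < (q ^ k)%:R :> R.
Proof. by rewrite ltr0n expn_gt0; apply/orP; left; apply/card_gt0P; exists 0. Qed.

Lemma density_ge0 : 0 <= density.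
Proof. by rewrite /density divr_ge0// ltW// q_gt0. Qed.

Lemma density_le1 : density <= 1.
Proof.
rewrite /density ler_pdivrMr ?q_gt0// mul1r ler_nat.
by rewrite (leq_trans (max_card _))// card_ffun card_ord.
Qed.

Lemma fluct_le1 n b : `|fluct n b| <= 1.
Proof.
have := density_ge0; have := density_le1; rewrite /fluct.
case: ifP => _; last by rewrite normr0.
by case: (_ \in B) => /= ? ?; rewrite ?mulr1n ?mulr0n ler_norml; apply/andP; split; lra.
Qed.

Lemma fluct_local n b b' : (forall i, (i < n * w + r)%N -> b i = b' i) ->
  fluct n b = fluct n b'.
Proof.
(* If p divides [n], both sides are 0. Otherwise n > 0 and, as w > 0, the coefficient of index 0 is
   among those that agree. *)
rewrite /fluct; have [_ _|pn bb'] := boolP (p %| n)%N; first by rewrite !andbF.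
have n0 : (0 < n)%N by case: n pn {bb'} => //; rewrite dvdn0.
rewrite bb'; last by rewrite addn_gt0 muln_gt0 n0 w0.
case: ifP => // _; congr ((_ \in B)%:R - _).
apply/ffunP => i; rewrite !ffunE; apply: eq_spow => j ji; apply: bb'.
by have := ltn_ord i; lia.
Qed.

(** By [spow_triangular], each coefficient of the window determines the corresponding letter of [e]
    once the earlier letters are known. *)
Lemma window_put_inj n b : b 0%N != 0 -> ~~ (p %| n)%N ->
  injective (fun e => window n (fun i => b i + put (n * w) e i)).
Proof.
move=> b0 pn e e' /= ee'.
have n0 : (0 < n)%N by case: n pn {ee'} => //; rewrite dvdn0.
have nw0 : (0 < n * w)%N by rewrite muln_gt0 n0.
have H i (ir : (i < r)%N) : e (Ordinal ir) = e' (Ordinal ir).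
  elim/ltn_ind: i ir => i IH ir.
  have := congr1 (fun v : word F r => v (Ordinal ir)) ee'; rewrite !ffunE /=.
  move=> /(spow_triangular _ _ _ _); rewrite /put leq_addr addKn.
  have extE (v : word F r) : ext v i = v (Ordinal ir).
    by rewrite /ext insubT; congr (v _); exact: val_inj.
  rewrite !extE => H; apply: (addrI (b (n * w + i)%N)); apply: H.
  - by rewrite addn_gt0 nw0.
  - by rewrite -(dvdn_pcharf hp).
  - by rewrite leqNgt nw0/= addr0.
  move=> j jJ; case: leqP => // nwj; congr (_ + _).
  have jr : (j - n * w < r)%N by lia.
  rewrite /ext insubT; have := IH (j - n * w)%N (ltac:(lia)) jr.
  by move=> H1; rewrite H1.
by apply/ffunP => -[i ir]; exact: H.
Qed.

(** The perturbation leaves b_0 alone. When [e] runs over all words, so does the window, by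
    injectivity on a finite set, and #|B| cancels q^r times the density. *)
Lemma sum_fluct_put n b :
  \sum_(e : word F r) fluct n (fun i => b i + put (n * w) e i) = 0.
Proof.
rewrite /fluct; have [pn|pn] := boolP (p %| n)%N.
  by rewrite big1// => e _; rewrite andbF.
have n0 : (0 < n)%N by case: n pn => //; rewrite dvdn0.
have E (e : word F r) : b 0%N + put (n * w) e 0 = b 0%N.
  by rewrite /put leqNgt muln_gt0 n0 w0 addr0.
have [b0|b0] := boolP (b 0%N != 0); last first.
  by rewrite big1// => e _; rewrite E (negbTE b0).
under eq_bigr do rewrite E b0/=.
rewrite sumrB sumr_const cardT -cardE card_ffun card_ord.
have inj := window_put_inj b0 pn.
have := reindex_inj inj (P := xpredT) (F := fun v => (v \in B)%:R : R).
move=> /= <-; have -> : \sum_(v : word F r) (v \in B)%:R = #|B|%:R :> R.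
  by rewrite -sum1_card natr_sum [RHS]big_mkcond/=; apply: eq_bigr => v _; case: ifP.
by rewrite -[X in _ - X]mulr_natr /density divfK ?subrr// gt_eqF// q_gt0.
Qed.

(** Adding [put (n' * w) e] permutes the words. It does not affect [fluct n], which reads only
    coefficients below n w + r <= n' w, while [fluct n'] sums to 0 over [e]. *)
Lemma fluct_orthogonal n n' L : (n + r <= n')%N -> (n' * w + r <= L)%N ->
  \sum_(x : word F L) fluct n (ext x) * fluct n' (ext x) = 0.
Proof.
move=> nn' n'L; set S := LHS.
have nn'w : (n * w + r <= n' * w)%N by nia.
suff : (q ^ r)%:R * S = 0.
  by move/eqP; rewrite mulf_eq0 gt_eqF ?q_gt0//= => /eqP.
have SE (e : word F r) : S = \sum_(x : word F L)
    fluct n (ext x) * fluct n' (fun i => ext x i + put (n' * w) e i).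
  rewrite /S (reindex_inj (addIr (restr L (put (n' * w) e))))/=.
  apply: eq_bigr => x _.
  have xE i : (i < L)%N ->
      ext (x + restr L (put (n' * w) e)) i = ext x i + put (n' * w) e i.
    by move=> iL; rewrite /ext insubT !ffunE.
  congr (_ * _); last by apply: fluct_local => i iL; rewrite xE//; lia.
  apply: fluct_local => i iL; rewrite xE; last lia.
  by rewrite /put leqNgt (_ : (i < _)%N) ?addr0//; lia.
have -> : (q ^ r)%:R * S = \sum_(e : word F r) S.
  by rewrite sumr_const cardT -cardE card_ffun card_ord mulr_natl.
rewrite (eq_bigr _ (fun e _ => SE e)) exchange_big big1// => x _.
by rewrite -mulr_sumr sum_fluct_put mulr0.
Qed.

Definition fluct_sum N b : R := \sum_(n < N) fluct n.+1 b.

(** All such n' lie in an interval of length 2r; for n < r it starts at 0 by truncated subtraction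
    and still contains them. *)
Lemma count_near N n :
  (\sum_(n' < N) ((n' < n + r) && (n < n' + r)) <= 2 * r)%N.
Proof.
rewrite -(big_mkord xpredT (fun n' => (((n' < n + r) && (n < n' + r))%N : nat))).
rewrite [X in (X <= _)%N](_ : _ =
    size [seq n' <- iota 0 N | (n' < n + r)%N && (n < n' + r)%N]); last first.
  rewrite size_filter -sum1_count [RHS]big_mkcond /index_iota subn0.
  by apply: eq_bigr => n' _; case: ifP.
apply: (@leq_trans (size (iota (n - r) (2 * r)))); last by rewrite size_iota.
apply: uniq_leq_size; first by rewrite filter_uniq// iota_uniq.
by move=> n'; rewrite mem_filter !mem_iota; lia.
Qed.

(** In the expanded square, pairs at distance at least [r] vanish by orthogonality; each of the at
    most 2r other n' contributes at most 1 per word. *)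
Lemma fluct_sum_variance N L : (N * w + r <= L)%N ->
  \sum_(x : word F L) fluct_sum N (ext x) ^+ 2 <= (q ^ L)%:R * (N * (2 * r))%:R.
Proof.
move=> NL.
have E (x : word F L) : fluct_sum N (ext x) ^+ 2 =
    \sum_(n < N) \sum_(n' < N) fluct n.+1 (ext x) * fluct n'.+1 (ext x).
  by rewrite expr2 /fluct_sum mulr_suml; apply: eq_bigr => n _; rewrite mulr_sumr.
rewrite (eq_bigr _ (fun x _ => E x)) exchange_big/=.
have -> : (q ^ L)%:R * (N * (2 * r))%:R = \sum_(n < N) (q ^ L)%:R * (2 * r)%:R :> R.
  by rewrite sumr_const card_ord natrM mulrCA !mulr_natl.
apply: ler_sum => n _; rewrite exchange_big/=.
apply: (@le_trans _ _ (\sum_(n' < N) (q ^ L)%:R * ((n' < n + r) && (n < n' + r))%N%:R)).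
  apply: ler_sum => n' _; have [nn'|nn'] := boolP (_ && _).
    rewrite mulr1 (_ : (q ^ L)%:R = \sum_(x : word F L) 1); last first.
      by rewrite sumr_const cardT -cardE card_ffun card_ord.
    apply: ler_sum => x _; apply: le_trans (ler_norm _) _.
    by rewrite normrM mulr_ile1// fluct_le1.
  have n'N := ltn_ord n'; have nN := ltn_ord n.
  rewrite mulr0 le_eqVlt; apply/orP; left; apply/eqP.
  case: (leqP (n + r) n') => h.
    by apply: fluct_orthogonal; [lia|nia].
  under eq_bigr do rewrite mulrC.
  by apply: fluct_orthogonal; [lia|nia].
by rewrite -mulr_sumr ler_wpM2l ?ler0n// -natr_sum ler_nat count_near.
Qed.

End Orthogonality.

(** * A strong law of large numbers along the squares *)

Section StrongLaw.
Variable R : realType.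

Lemma square_floor N : exists M, (M ^ 2 <= N < M.+1 ^ 2)%N.
Proof.
elim: N => [|N [M /andP[MN NM]]]; first by exists 0%N.
have [h|h] := ltnP N.+1 (M.+1 ^ 2); first by exists M; rewrite h andbT leqW.
by exists M.+1; rewrite h/=; move: NM; rewrite -!mulnn; nia.
Qed.

(** From (M+1)^2 up to the next square, [T] moves by at most 2(M+1), which is negligible against
    (M+1)^2. *)
Lemma cvg0_along_squares (T : nat -> R) :
  (forall N, `|T N.+1 - T N| <= 1) ->
  (forall e : R, 0 < e -> exists M0, forall M, (M0 <= M)%N ->
     `|T (M.+1 ^ 2)%N| <= e * (M.+1 ^ 2)%:R) ->
  (N%:R^-1 * T N) @[N --> \oo] --> (0 : R).
Proof.
move=> T1 Tsq; apply/cvgr0Pnorm_le => e e0.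
have lip M d : `|T (M + d)%N - T M| <= d%:R.
  elim: d => [|d IH]; first by rewrite addn0 subrr normr0.
  have -> : T (M + d.+1)%N - T M =
      (T (M + d)%N - T M) + (T (M + d).+1 - T (M + d)%N) by rewrite addnS; ring.
  by apply: le_trans (ler_normD _ _) _; rewrite -natr1; exact: lerD IH (T1 _).
have e2 : 0 < e / 2 by rewrite divr_gt0.
have [M0 HM0] := Tsq _ e2.
(* For M >= M1 the gap 2(M+1) is at most e/2 times (M+1)^2. *)
have [M1 HM1] : exists M1 : nat, 4 / e <= M1%:R.
  by exists (Num.truncn (4 / e)).+1; apply/ltW/truncnS_gt.
exists ((M0 + M1).+1 ^ 2)%N => // N /= MN.
have [[|M] /andP[ML MU]] := square_floor N.
  by exfalso; move: MN MU; rewrite -!mulnn; nia.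
have MM : (M0 + M1 <= M)%N.
  by rewrite -ltnS leqNgt; apply/negP => h; move: MN MU; rewrite -!mulnn; nia.
have N0 : 0 < N%:R :> R by rewrite ltr0n (leq_trans _ ML)// expn_gt0.
rewrite normrM normfV normr_nat ler_pdivrMl//.
have -> : N = (M.+1 ^ 2 + (N - M.+1 ^ 2))%N by rewrite subnKC.
set d := (N - M.+1 ^ 2)%N.
rewrite -[T _](subrK (T (M.+1 ^ 2)%N)).
apply: le_trans (ler_normD _ _) _.
have dM : d%:R <= 2 * M.+1%:R :> R.
  by rewrite -natrM ler_nat /d; move: MU; rewrite -!mulnn; nia.
have M4 : 4 <= e * M.+1%:R.
  rewrite mulrC -ler_pdivrMr//; apply: le_trans HM1 _.
  by rewrite ler_nat; lia.
have H1 := lip (M.+1 ^ 2)%N d.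
have H2 := HM0 M (leq_trans (leq_addr _ _) MM).
rewrite natrD [leRHS]mulrC mulrDr.
have d0 : 0 <= e * d%:R by rewrite mulr_ge0// ltW.
have H3 : 2 * M.+1%:R <= e / 2 * (M.+1 ^ 2)%:R.
  rewrite natrX expr2 mulrA ler_wpM2r ?ler0n//.
  by rewrite -mulrA mulrC -mulrA; lra.
lra.
Qed.

Lemma sum_inv_sq_le K : \sum_(i < K) (i.+1%:R ^+ 2)^-1 <= 2 :> R.
Proof.
(* The subtracted term lets the induction close: from K to K+1 it drops by at least 1/(K+1)^2. *)
suff : \sum_(i < K) (i.+1%:R ^+ 2)^-1 <= 2 - 2 / K.+1%:R :> R.
  move=> /le_trans; apply; rewrite gerBl// divr_ge0//.
elim: K => [|K IH]; first by rewrite big_ord0 divr1 subrr.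
rewrite big_ord_recr/=; apply: le_trans (lerD IH (lexx _)) _.
have k0 : 0 < K%:R + 1 :> R by rewrite natr1 ltr0n.
have H : 2 / K.+1%:R - 2 / K.+2%:R - (K.+1%:R ^+ 2)^-1 =
  K%:R / (K.+1%:R ^+ 2 * K.+2%:R) :> R.
  by rewrite -[K.+2%:R]natr1 -[K.+1%:R]natr1; field; rewrite !gt_eqF//; lra.
have : 0 <= K%:R / (K.+1%:R ^+ 2 * K.+2%:R) :> R by rewrite divr_ge0.
rewrite -{}H; set x := 2 / K.+1%:R; set y := 2 / K.+2%:R; set z := (_ ^+ 2)^-1.
by move: x y z => x y z; lra.
Qed.

Variables (F : finFieldType) (p : nat).
Hypothesis hp : p \in [pchar F].
Variables (w r : nat) (B : {set word F r}).
Hypothesis w0 : (0 < w)%N.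
Variable mu : probability (Omes F) R.
Hypothesis hmu : is_haar_on [set: Omes F] mu.
Local Notation q := #|F|.
Local Notation fluct_sum := (@fluct_sum R F p w r B).

Definition deviation (e : R) N : set (Omes F) :=
  [set b | e * N%:R <= `|fluct_sum N b|].

(** The same event on finite words: [fluct_sum N] reads only N w + r coefficients. *)
Definition deviation_words (e : R) N : {set word F (N * w + r)} :=
  [set x | e * N%:R <= `|fluct_sum N (ext x)|]%SET.

Lemma deviationE e N : deviation e N = cylinder (deviation_words e N).
Proof.
apply/seteqP; split=> b; rewrite /deviation /cylinder/= inE;
  rewrite (_ : fluct_sum N (ext _) = fluct_sum N b)//;
  by apply: eq_bigr => n _; apply: fluct_local => // i ib;
    apply: ext_restr; have := ltn_ord n; nia.
Qed.

(** Chebyshev's inequality for the counting measure on words. *)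
Lemma pr_deviation e N : 0 < e -> (0 < N)%N ->
  pr mu (deviation_words e N) <= (2 * r)%:R / (e ^+ 2 * N%:R).
Proof.
move=> e0 N0; rewrite (haar_pr hmu); set L := (N * w + r)%N.
have N0R : 0 < N%:R :> R by rewrite ltr0n.
have H := @fluct_sum_variance R F p hp w r B w0 N L (leqnn _).
rewrite ler_pdivrMr ?q_gt0//.
have : #|deviation_words e N|%:R * (e * N%:R) ^+ 2 <= (q ^ L)%:R * (N * (2 * r))%:R.
  apply: le_trans H; rewrite [leRHS](bigID (mem (deviation_words e N)))/=.
  rewrite mulr_natl -sumr_const -[leLHS]addr0; apply: lerD.
    apply: ler_sum => x; rewrite inE => xd.
    by rewrite -[leRHS]real_normK ?num_real// lerXn2r// nnegrE mulr_ge0// ltW.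
  by apply: sumr_ge0 => x _; exact: sqr_ge0.
rewrite -ler_pdivlMr; last by rewrite exprn_gt0// mulr_gt0.
move=> /le_trans; apply; rewrite le_eqVlt; apply/orP; left; apply/eqP.
by rewrite natrM; field; rewrite !gt_eqF.
Qed.

(** The Chebyshev bound is of order 1/N, which is summable over N = (M+1)^2. *)
Lemma deviation_sq_summable e : 0 < e ->
  (\sum_(0 <= M <oo) mu (deviation e (M.+1 ^ 2)) < +oo)%E.
Proof.
move=> e0; set C : R := (2 * r)%:R / e ^+ 2 * 2.
apply: (@le_lt_trans _ _ C%:E); last exact: ltry.
apply: lime_le; first exact: is_cvg_nneseries.
apply: nearW => K; rewrite big_mkord.
rewrite (eq_bigr (fun M : 'I_K => (pr mu (deviation_words e (M.+1 ^ 2)))%:E)); last first.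
  by move=> M _; rewrite deviationE prE.
rewrite sumEFin lee_fin.
apply: (@le_trans _ _ (\sum_(M < K) (2 * r)%:R / e ^+ 2 * (M.+1%:R ^+ 2)^-1)).
  apply: ler_sum => M _; rewrite -mulrA -invfM -natrX.
  by apply: pr_deviation => //; rewrite expn_gt0.
rewrite -mulr_sumr ler_wpM2l ?sum_inv_sq_le// divr_ge0// ?exprn_ge0 ?ltW//.
Qed.

(** Borel-Cantelli for each tolerance 1/(j+1) controls the sums along the squares almost surely;
    countably many j suffice, and increments of at most 1 fill the gaps. *)
Lemma fluct_ae :
  {ae mu, forall b : Omes F, (N%:R^-1 * fluct_sum N b) @[N --> \oo] --> (0 : R)}.
Proof.
have H (j : nat) : {ae mu, forall b : Omes F, exists M0, forall M, (M0 <= M)%N ->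
    `|fluct_sum (M.+1 ^ 2) b| <= j.+1%:R^-1 * (M.+1 ^ 2)%:R}.
  have j0 : 0 < j.+1%:R^-1 :> R by rewrite invr_gt0.
  pose D M := deviation j.+1%:R^-1 (M.+1 ^ 2).
  have mD M : measurable (D M).
    by rewrite /D deviationE; exact: measurable_cylinder.
  exists (lim_sup_set D); split.
  - apply: bigcap_measurable => // n _; apply: bigcup_measurable => M _; exact: mD.
  - exact: lim_sup_set_cvg0 mD (deviation_sq_summable j0).
  move=> b /= Hb n _; apply: contrapT => Hn; apply: Hb; exists n => M nM.
  by apply/ltW; rewrite ltNge; apply/negP => h; apply: Hn; exists M.
have := ae_foralln H; apply: filterS => b Hb; apply: cvg0_along_squares.
  move=> N; have -> : fluct_sum N.+1 b = fluct_sum N b + fluct R p w B N.+1 b.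
    by rewrite /fluct_sum/= big_ord_recr.
  by rewrite addrAC subrr add0r; exact: fluct_le1.
move=> e e0; have [j je] : exists j : nat, e^-1 <= j.+1%:R.
  by exists (Num.truncn e^-1); apply/ltW/truncnS_gt.
have [M0 HM0] := Hb j; exists M0 => M /HM0 /le_trans; apply.
by rewrite ler_wpM2r// invf_ple// posrE.
Qed.

End StrongLaw.

(** * Averages over the multiples of an integer *)

Section Averages.
Variable R : realType.

Lemma cvg_divn d : (0 < d)%N -> ((N %/ d)%N @[N --> \oo] --> \oo).
Proof.
move=> d0 A [M _ MA]; exists (M * d)%N => // N /= MN; apply: MA => /=.
by rewrite leq_divRL.
Qed.

Lemma cvg_natinv : (N%:R^-1 : R) @[N --> \oo] --> (0 : R).
Proof. by rewrite -(cvg_shiftn 1%N); under eq_fun do rewrite addn1; exact: cvg_harmonic. Qed.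

(** The difference from 1/d is (N mod d)/(d N), at most 1/N. *)
Lemma cvg_divn_ratio d : (0 < d)%N ->
  (N%:R^-1 * (N %/ d)%:R : R) @[N --> \oo] --> (d%:R^-1 : R).
Proof.
move=> d0; apply/cvgrPdist_le => e e0.
have /cvgr0Pnorm_le/(_ _ e0) := cvg_natinv.
apply: filterS2 (nbhs_infty_gt 0%N) => N N0 HN.
have N0R : 0 < N%:R :> R by rewrite ltr0n.
have d0R : 0 < d%:R :> R by rewrite ltr0n.
apply: le_trans HN; rewrite [leRHS]ger0_norm ?invr_ge0//.
have -> : d%:R^-1 - N%:R^-1 * (N %/ d)%:R = N%:R^-1 * ((N %% d)%:R / d%:R) :> R.
  have : N%:R = (N %/ d)%:R * d%:R + (N %% d)%:R :> R.
    by rewrite -natrM -natrD -divn_eq.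
  by move=> H; rewrite -[(N %% d)%:R](addKr ((N %/ d)%:R * d%:R)) -H; field; rewrite !gt_eqF.
rewrite ger0_norm; last by rewrite mulr_ge0 ?invr_ge0// divr_ge0.
rewrite -[leRHS]mulr1 ler_wpM2l ?invr_ge0// ler_pdivrMr// mul1r ler_nat.
by rewrite ltnW// ltn_mod.
Qed.

Lemma sum_dvdn (g : nat -> R) d N : (0 < d)%N ->
  \sum_(n < N) (d %| n.+1)%:R * g n.+1 = \sum_(m < N %/ d) g (d * m.+1)%N.
Proof.
move=> d0; elim: N => [|N IH]; first by rewrite div0n !big_ord0.
rewrite big_ord_recr/= IH divnS//; case: (boolP (d %| N.+1)%N) => [dN|_].
  rewrite add1n big_ord_recr/= mul1r; congr (_ + g _).
  by move: dN (divnS N d0) => /[dup] /divnK dN -> /=; rewrite add1n => H; rewrite -H mulnC dN.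
by rewrite add0n mul0r addr0.
Qed.

Lemma sum_dvdn1 d N : (0 < d)%N ->
  \sum_(n < N) (d %| n.+1)%:R = (N %/ d)%:R :> R.
Proof.
move=> d0; have := sum_dvdn (fun=> 1) N d0; rewrite sumr_const card_ord => <-.
by apply: eq_bigr => n _; rewrite mulr1.
Qed.

Lemma cvg_near_eq (f g : nat -> R) (l : R) : (forall N, (0 < N)%N -> f N = g N) ->
  g @ \oo --> l -> f @ \oo --> l.
Proof.
move=> fg; apply: cvg_trans; apply: near_eq_cvg.
by exists 1%N => // N /= /fg ->.
Qed.

End Averages.

(** * Exponents prime to p, for almost every series *)

Section Laurent.
Variables (R : realType) (F : finFieldType) (p : nat).
Hypothesis hp : p \in [pchar F].
Local Notation q := #|F|.
Let p_pr : prime p := pcharf_prime hp.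
Let p_gt0 : (0 < p)%N := prime_gt0 p_pr.
Let p0R : 0 < p%:R :> R.
Proof. by rewrite ltr0n. Qed.

Definition mfun_O (h : Omes F -> Omes F) (mh : measurable_fun setT h) :
  {mfun Omes F >-> Omes F} := HB.pack h (isMeasurableFun.Build _ _ _ _ h mh).

Lemma measurable_shift d : measurable_fun setT (shift d : Omes F -> Omes F).
Proof.
apply: measurable_fun_O => y r; exists (d + r)%N => z zy i ir.
by rewrite /shift zy// ltn_add2l.
Qed.

Lemma measurable_stretch k :
  measurable_fun setT (stretch p k : Omes F -> Omes F).
Proof.
apply: measurable_fun_O => y r; exists r => z zy i ir; rewrite /stretch.
by case: ifP => // _; rewrite zy// (leq_ltn_trans _ ir)// leq_div.
Qed.

Section Haar.
Variable mu : probability (Omes F) R.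
Hypothesis hmu : is_haar_on [set: Omes F] mu.

(** The preimage of the cylinder of [B] under [stretch p k] is again given by [r] coefficients,
    since index i reads index i / p^k <= i. *)
Definition stretch_preim k r (B : {set word F r}) : {set word F r} :=
  [set x | restr r (stretch p k (ext x)) \in B]%SET.

Lemma in_stretch_preim k r (B : {set word F r}) (y : nat -> F) :
  (restr r y \in stretch_preim k B) = (restr r (stretch p k y) \in B).
Proof.
rewrite inE; congr (_ \in B); apply/eq_restr => i ir; rewrite /stretch.
by case: ifP => // _; rewrite ext_restr// (leq_ltn_trans _ ir)// leq_div.
Qed.

(** The image of [mu] under the additive map [stretch p k] is a Haar measure on its range S_k;
    uniqueness on cylinders identifies it with [nu]. *)
Lemma haar_Sk_pr k (nu : probability (Omes F) R) : is_haar_on (Sk p k) nu ->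
  forall r (B : {set word F r}), pr nu B = density R (stretch_preim k B).
Proof.
move=> hnu r B.
pose nu' := distribution mu (mfun_O (measurable_stretch k)).
have hnu' : is_haar_on (Sk p k) (nu' : probability _ _).
  rewrite -(range_stretch hp); apply: pushforward_haar => // a b.
  exact: stretchD.
have subS (s t : Omes F) : Sk p k s -> Sk p k t -> Sk p k (fun i => t i - s i).
  by move=> Ss St i pi; rewrite Ss// St// subr0.
rewrite (haar_pr_unique (@measurable_Sk F p k) subS hnu hnu').
rewrite /density -(haar_pr hmu) /pr; congr (fine (mu _)).
by apply/seteqP; split=> y; rewrite /cylinder/= in_stretch_preim.
Qed.

(** Averages are over all exponents up to N, so the limit carries the density 1 - 1/p of those prime
    to p. *)
Definition equidistr_coprime (x : laurent F) := forall r (B : {set word F r}),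
  (N%:R^-1 * \sum_(n < N)
    (~~ (p %| n.+1)%N && (restr r (bracket (lpow x n.+1)) \in B))%:R) @[N --> \oo]
  --> (1 - p%:R^-1) * density R B.

(** For n prime to p the indicator is [fluct] plus the density; the number of such n is N minus the
    number of multiples of p. *)
Lemma fluct_equidistr w r (B : {set word F r}) (b : nat -> F) : b 0%N != 0 ->
  (N%:R^-1 * fluct_sum R p w B N b) @[N --> \oo] --> (0 : R) ->
  (N%:R^-1 * \sum_(n < N) (~~ (p %| n.+1)%N &&
    (restr r (bracket (lpow (Laurent (- w%:Z) b) n.+1)) \in B))%:R) @[N --> \oo]
  --> (1 - p%:R^-1) * density R B.
Proof.
move=> b0 H.
apply: (@cvg_near_eq _ _ (fun N => N%:R^-1 * fluct_sum R p w B N b +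
  (1 - N%:R^-1 * (N %/ p)%:R) * density R B)).
  move=> N N0; have N0R : N%:R != 0 :> R by rewrite pnatr_eq0 -lt0n.
  have -> : 1 - N%:R^-1 * (N %/ p)%:R =
      N%:R^-1 * \sum_(n < N) (1 - (p %| n.+1)%:R) :> R.
    by rewrite sumrB sum_dvdn1// sumr_const card_ord mulrBr mulVf.
  rewrite -mulrA -mulrDr mulr_suml -big_split/=; congr (_ * _).
  apply: eq_bigr => n _.
  have -> : restr r (bracket (lpow (Laurent (- w%:Z) b) n.+1)) = window w r n.+1 b.
    by apply/ffunP => i; rewrite !ffunE bracket_neg.
  rewrite /fluct b0/=; case: (p %| n.+1)%N => /=; first by rewrite subrr mul0r addr0.
  by rewrite subr0 mul1r subrK.
rewrite -[X in _ --> X]add0r; apply: cvgD => //.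
apply: cvgMr_tmp; apply: cvgB; first exact: cvg_cst.
exact: cvg_divn_ratio.
Qed.

Lemma ae_distribution (h : {mfun Omes F >-> Omes F}) (P : Omes F -> Prop) :
  {ae distribution mu h, forall b, P b} -> {ae mu, forall a, P (h a)}.
Proof.
move=> [A [mA A0 PA]]; exists (h @^-1` A); split => //.
  by rewrite -[X in measurable X]setTI; exact: measurable_funP.
by move=> a /= Ha; apply: PA.
Qed.

(** The order of vanishing [d] of [a] takes countably many values. For each, [shift d] preserves
    Haar measure and brings x to the form pi^(-w) b with b_0 nonzero, where [fluct_ae] applies. *)
Lemma equidistr_coprime_ae m :
  {ae mu, forall a : Omes F, pabs_gt1 (Laurent m a) -> equidistr_coprime (Laurent m a)}.
Proof.
have H d : {ae mu, forall a : Omes F, (m + d%:Z < 0)%R ->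
    (forall i, (i < d)%N -> a i = 0) -> a d != 0 -> equidistr_coprime (Laurent m a)}.
  have [md|md] := ltP (m + d%:Z)%R 0; last by apply: aeW.
  have [w w0 mdw] : exists2 w : nat, (0 < w)%N & (m + d%:Z = - w%:Z)%R.
    by exists (absz (m + d%:Z)%R); lia.
  pose mu' := distribution mu (mfun_O (measurable_shift d)).
  have hmu' : is_haar_on [set: Omes F] (mu' : probability _ _).
    have -> : [set: Omes F] = range (mfun_O (measurable_shift d)).
      (* The first [d] entries, equal to [y 0] by truncated subtraction, are discarded by the
         shift. *)
      apply/seteqP; split=> // y _; exists (fun i => y (i - d)%N) => //.
      by apply/funext => i; rewrite /= /shift addKn.
    exact: pushforward_haar.
  have H1 : {ae mu', forall b, forall r (B : {set word F r}),
      (N%:R^-1 * fluct_sum R p w B N b) @[N --> \oo] --> (0 : R)}.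
    by apply: ae_foralln => r; apply: filter_forall => B; exact: fluct_ae.
  move/ae_distribution : H1; apply: filterS => a Ha _ a0 ad r B.
  under eq_fun do under eq_bigr do rewrite (bracket_shift _ _ a0) mdw.
  by apply: fluct_equidistr; [rewrite /shift addn0|exact: Ha].
move/ae_foralln : H; apply: filterS => a Ha [v [[av aj] v0]].
(* The coefficient at the valuation [v] is nonzero, so [v - m] is a natural number [d]. *)
move: av aj; rewrite /lcoef/=; case E : (v - m)%R => [d|//] ad aj; last by rewrite eqxx in ad.
apply: (Ha d) => //; first by rewrite -E addrC subrK.
move=> i id; have := aj (m + i%:Z)%R; rewrite addrAC subrr add0r; apply.
by rewrite -[v](subrK m) E addrC ltrD2r.
Qed.

End Haar.

(** * Exponents exactly divisible by p^k *)

Section Equidistributed.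
Variable x : laurent F.
Hypothesis xE : equidistr_coprime x.
Local Notation u n := (bracket (lpow x n)).

Definition exact_pow k n := (p ^ k %| n)%N && ~~ (p ^ k.+1 %| n)%N.

(** Write n = p^k m: exactness means that p does not divide m, and [bracketF] expresses [x^n]
    through [x^m]. *)
Lemma sum_exact_pow k r (B : {set word F r}) N :
  \sum_(n < N) (exact_pow k n.+1 && (restr r (u n.+1) \in B))%:R =
  \sum_(m < N %/ p ^ k) (~~ (p %| m.+1)%N &&
    (restr r (u m.+1) \in stretch_preim k B))%:R :> R.
Proof.
have pk0 : (0 < p ^ k)%N by rewrite expn_gt0 p_gt0.
pose g n : R := (~~ (p ^ k.+1 %| n)%N && (restr r (u n) \in B))%:R.
transitivity (\sum_(n < N) (p ^ k %| n.+1)%:R * g n.+1).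
  apply: eq_bigr => n _; rewrite /exact_pow /g.
  by case: (_ %| _)%N; rewrite ?mul1r ?mul0r.
rewrite sum_dvdn//; apply: eq_bigr => m _; rewrite /g in_stretch_preim//.
by rewrite bracketF// expnSr dvdn_pmul2l.
Qed.

(** With M the integer part of N / p^k, the average is M/N times the average over m <= M of
    [equidistr_coprime]. *)
Lemma exact_pow_cvg k r (B : {set word F r}) :
  (N%:R^-1 * \sum_(n < N) (exact_pow k n.+1 && (restr r (u n.+1) \in B))%:R) @[N --> \oo]
  --> p%:R ^- k * ((1 - p%:R^-1) * density R (stretch_preim k B)).
Proof.
have pk0 : (0 < p ^ k)%N by rewrite expn_gt0 p_gt0.
pose D M : R := \sum_(m < M)
  (~~ (p %| m.+1)%N && (restr r (u m.+1) \in stretch_preim k B))%:R.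
rewrite (_ : (fun N => _) = (fun N => (N%:R^-1 * (N %/ p ^ k)%:R) *
    ((N %/ p ^ k)%:R^-1 * D (N %/ p ^ k)%N))); last first.
  apply/funext => N; rewrite -mulrA sum_exact_pow -/(D _); congr (_ * _).
  have [->|M0] := eqVneq (N %/ p ^ k)%N 0%N; first by rewrite /D big_ord0 !mulr0.
  by rewrite mulVKf ?pnatr_eq0.
rewrite -natrX; apply: cvgM; first exact: cvg_divn_ratio.
exact: (cvg_comp _ _ (cvg_divn pk0) (@xE r (stretch_preim k B))).
Qed.

Lemma density_setT r : density R [set: word F r]%SET = 1.
Proof.
by rewrite /density cardsT card_ffun card_ord divff// gt_eqF// q_gt0.
Qed.

Lemma stretch_preimT k r : stretch_preim k [set: word F r]%SET = [set: word F r]%SET.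
Proof. by apply/setP => v; rewrite !inE. Qed.

(** An increasing enumeration meets each admissible exponent up to [s J] once, and 0 is not
    admissible. *)
Lemma sum_exact_enum (s : nat -> nat) (k : nat) (g : nat -> R) J :
  {homo s : i j / (i < j)%N} -> range s = [set n | exact_pow k n] ->
  \sum_(j < J.+1) g (s j) = \sum_(n < s J) (exact_pow k n.+1)%:R * g n.+1.
Proof.
move=> hs rs; have ms := leq_mono hs.
have sP n : exact_pow k n -> exists j, s j = n.
  move=> kn; have : range s n by rewrite rs.
  by move=> [j _ <-]; exists j.
have sE j : exact_pow k (s j).
  by have : range s (s j) by [exists j]; rewrite rs.
transitivity (\sum_(n <- [seq n <- iota 1 (s J) | exact_pow k n]) g n).
  rewrite -(big_mkord xpredT (fun j => g (s j))) -(big_map s xpredT g).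
  apply: perm_big; apply: uniq_perm.
  - by rewrite map_inj_uniq ?iota_uniq//; exact: inc_inj ms.
  - by rewrite filter_uniq// iota_uniq.
  move=> n; rewrite mem_filter mem_iota; apply/mapP/idP.
    move=> [j]; rewrite mem_iota => jJ ->; rewrite sE/=.
    have : (s j <= s J)%N by rewrite ms; lia.
    have : s j != 0%N.
      by apply/eqP => sj; have := sE j; rewrite sj /exact_pow !dvdn0.
    lia.
  move=> /andP[/sP[j <-]] /andP[_]; rewrite add1n ltnS ms => jJ.
  by exists j => //; rewrite mem_iota; lia.
rewrite big_filter (_ : iota 1 _ = index_iota 1 (s J).+1); last first.
  by rewrite /index_iota subn1.
rewrite big_mkcond big_add1/= big_mkord.
by apply: eq_bigr => n _; case: ifP; rewrite ?mul1r ?mul0r.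
Qed.

(** The average along [s] is the quotient of two averages over N = s J, one for the given word and
    one for all words; the common factor [c] cancels. *)
Lemma equidistr_exact_pow (mu nu : probability (Omes F) R) k (s : nat -> nat) :
  is_haar_on [set: Omes F] mu -> is_haar_on (Sk p k) nu ->
  {homo s : i j / (i < j)%N} -> range s = [set n | exact_pow k n] ->
  unif_distr nu (fun j => u (s j)).
Proof.
move=> hmu hnu hs rs; apply: unif_distr_word => r v; set B := [set v]%SET.
rewrite (haar_Sk_pr hmu hnu).
pose c : R := p%:R ^- k * (1 - p%:R^-1).
have c0 : c != 0.
  rewrite mulf_neq0// ?invr_neq0 ?expf_neq0 ?gt_eqF// subr_gt0 invf_lt1//.
  by rewrite ltr1n prime_gt1.
pose A (C : {set word F r}) N : R :=
  N%:R^-1 * \sum_(n < N) (exact_pow k n.+1 && (restr r (u n.+1) \in C))%:R.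
have sS j : (j <= s j)%N.
  by elim: j => // j IH; apply: leq_ltn_trans IH _; exact: hs.
have s_oo : s J @[J --> \oo] --> \oo.
  move=> C [M _ MC]; exists M => // J /= MJ; apply: MC => /=.
  exact: leq_trans MJ (sS J).
have AE (C : {set word F r}) J :
    A C (s J) = (s J)%:R^-1 * \sum_(j < J.+1) (restr r (u (s j)) \in C)%:R.
  rewrite (sum_exact_enum (fun n => (restr r (u n) \in C)%:R) J hs rs).
  by congr (_ * _); apply: eq_bigr => n _; case: exact_pow; rewrite ?mul1r ?mul0r.
apply: (@cvg_near_eq _ _ (fun J => A B (s J) / A [set: word F r]%SET (s J))).
  move=> J J0; have sJ0 : (s J)%:R != 0 :> R.
    by rewrite pnatr_eq0 -lt0n (leq_trans J0)// sS.
  rewrite !AE; have -> : \sum_(j < J.+1) (restr r (u (s j)) \in [set: word F r]%SET)%:R = J.+1%:R :> R.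
    by rewrite (eq_bigr (fun=> 1)) ?sumr_const ?card_ord// => j _; rewrite inE.
  by rewrite -mulf_div divff ?invr_eq0// mul1r mulrC.
have cA (C : {set word F r}) :
    A C (s J) @[J --> \oo] --> c * density R (stretch_preim k C).
  rewrite /c -mulrA; exact: (cvg_comp _ _ s_oo (@exact_pow_cvg k r C)).
have -> : density R (stretch_preim k B) =
  (c * density R (stretch_preim k B)) / (c * density R (stretch_preim k [set: word F r]%SET)).
  by rewrite stretch_preimT density_setT mulr1 mulrAC divff// mul1r.
apply: cvgM => //; apply: cvgV => //.
by rewrite stretch_preimT density_setT mulr1.
Qed.

End Equidistributed.
End Laurent.

(** * Summation over k and equidistribution for [mustar] *)

Section Main.
Variables (R : realType) (F : finFieldType) (p : nat).
Hypothesis hp : p \in [pchar F].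
Local Notation q := #|F|.
Let p_pr : prime p := pcharf_prime hp.
Let p_gt0 : (0 < p)%N := prime_gt0 p_pr.
Let p0R : 0 < p%:R :> R.
Proof. by rewrite ltr0n. Qed.
Let ip1 : 0 < 1 - p%:R^-1 :> R.
Proof. by rewrite subr_gt0 invf_lt1// ltr1n prime_gt1. Qed.

Lemma exact_pow_decomposition K n :
  \sum_(k < K) (exact_pow p k n)%:R + (p ^ K %| n)%:R = 1 :> R.
Proof.
elim: K => [|K IH]; first by rewrite big_ord0 add0r expn0 dvd1n.
rewrite big_ord_recr/= -addrA -[RHS]IH; congr (_ + _); rewrite /exact_pow.
have [pK|pK] := boolP (p ^ K %| n)%N.
  by case: (p ^ K.+1 %| n)%N; rewrite ?add0r ?addr0.
rewrite add0r; case: (boolP (p ^ K.+1 %| n)%N) => // h; exfalso.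
by move/negP: pK; apply; apply: dvdn_trans h; rewrite expnS dvdn_mull.
Qed.

(** The stretch for k = 0 is the identity, so [mu] enters the series as the term k = 0. *)
Lemma stretch_preim0 r (B : {set word F r}) : stretch_preim p 0 B = B.
Proof.
apply/setP => v; rewrite -[in RHS](extK v) inE (_ : stretch p 0 (ext v) = ext v)//.
by apply/funext => i; rewrite /stretch expn0 dvd1n divn1 expr1.
Qed.

Section Mustar.
Variables (mu : probability (Omes F) R) (muk : nat -> probability (Omes F) R)
  (mustar : probability (Omes F) R).
Hypothesis hmu : is_haar_on [set: Omes F] mu.
Hypothesis hmuk : forall k : nat, (0 < k)%N -> is_haar_on (Sk p k) (muk k).
Hypothesis hstar : forall (a : nat -> F) (r : nat),
  mustar (disk a r) =
  ((1 - p%:R^-1)%:E *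
   (mu (disk a r) +
    \sum_(1 <= k <oo) ((p%:R ^- k)%:E * muk k (disk a r `&` Sk p k))))%E.

(** [S] collects the terms k < K of [mustar]; the omitted ones are at most 1 - 1/p times the
    geometric tail from K on, which is p^(-K). *)
Lemma mustar_truncation r (x : word F r) K (S : R) : (0 < K)%N ->
  S = \sum_(k < K) p%:R ^- k *
    ((1 - p%:R^-1) * density R (stretch_preim p k [set x]%SET)) ->
  S <= pr mustar [set x] <= S + p%:R ^- K.
Proof.
move=> K0 SK; pose dens k := density R (stretch_preim p k [set x]%SET).
have disk_x : disk (ext x) r = cylinder [set x] by rewrite diskE extK.
have mukE k : (0 < k)%N ->
    ((p%:R ^- k)%:E * muk k (disk (ext x) r `&` Sk p k))%E = (p%:R ^- k * dens k)%:E.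
  move=> k0; have hk := hmuk k0; rewrite EFinM; congr (_ * _)%E.
  rewrite /dens -(haar_Sk_pr hp hmu hk) -prE disk_x.
  have mC := @measurable_cylinder F r [set x].
  have mS := @measurable_Sk F p k.
  apply/eqP; rewrite eq_le; apply/andP; split.
    by apply: le_measure; rewrite ?inE//; exact: measurableI.
  (* [muk k] is concentrated on S_k, so intersecting with S_k loses no mass. *)
  have SC0 : muk k (~` Sk p k) = 0%E.
    by rewrite probability_setC// [X in (_ - X)%E](hk.1) subee.
  rewrite -[leRHS]adde0 -SC0.
  apply: le_trans (measureU2 _ _ _); [|exact: measurableI|exact: measurableC].
  apply: le_measure; rewrite ?inE//.
    by apply: measurableU; [exact: measurableI|exact: measurableC].
  by move=> y Cy; have [Sy|Sy] := pselect (Sk p k y); [left|right].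
have dens0 k : 0 <= p%:R ^- k * dens k.
  by rewrite mulr_ge0 ?density_ge0// invr_ge0 exprn_ge0.
have dens_le k : p%:R ^- k * dens k <= p%:R ^- k.
  by rewrite -[leRHS]mulr1 ler_wpM2l ?density_le1// invr_ge0 exprn_ge0.
pose T n := \sum_(1 <= k < n) p%:R ^- k * dens k.
pose X : \bar R := (\sum_(1 <= k <oo) (p%:R ^- k * dens k)%:E)%E.
have TX n : ((T n)%:E <= X)%E.
  rewrite /T -sumEFin; apply: nneseries_lim_ge => k _ _.
  by rewrite lee_fin.
have XT n : (0 < n)%N -> (X <= (T n + p%:R ^- n / (1 - p%:R^-1))%:E)%E.
  move=> n0; apply: lime_le.
    by apply: is_cvg_nneseries => k _ _; rewrite lee_fin.
  exists n => // n' /= nn'; rewrite sumEFin lee_fin.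
  have -> : n' = (n + (n' - n))%N by rewrite subnKC.
  move: (n' - n)%N => d.
  (* The exact geometric sum of the [d] added bounds makes the induction on [d] close. *)
  suff : T (n + d)%N <= T n + (p%:R ^- n - p%:R ^- (n + d)) / (1 - p%:R^-1).
    move=> /le_trans; apply; rewrite lerD2l; apply: ler_wpM2r.
      by rewrite invr_ge0 ltW.
    by rewrite gerBl invr_ge0 exprn_ge0// ltW.
  elim: d => [|d IH]; first by rewrite addn0 subrr mul0r addr0.
  rewrite addnS /T big_nat_recr/=; last by rewrite (leq_trans n0)// leq_addr.
  apply: le_trans (lerD IH (dens_le _)) _.
  rewrite le_eqVlt; apply/orP; left; apply/eqP; rewrite -addrA; congr (_ + _).
  have c0 : 1 - p%:R^-1 != 0 :> R by rewrite gt_eqF.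
  by apply: (mulIf c0); rewrite mulrDl !divfK// exprS invfM; ring.
have [t Xt] : exists t, X = t%:E.
  by have := TX 1%N; have := XT 1%N isT; case: (X) => [t _ _|//|//]; exists t.
have mE : pr mustar [set x] = (1 - p%:R^-1) * (dens 0%N + t).
  rewrite /pr -disk_x hstar.
  rewrite (_ : (\sum_(1 <= k <oo) _)%E = X); last first.
    congr (lim (_ @ \oo)); apply/funext => n.
    by apply: eq_big_nat => k /andP[k0 _]; exact: mukE.
  rewrite Xt disk_x prE (haar_pr hmu)/= /dens.
  by rewrite stretch_preim0.
have SE : S = (1 - p%:R^-1) * (dens 0%N + T K).
  rewrite SK /T mulrDr; case: K K0 {SK} => // K _; rewrite big_ord_recl expr0 invr1 mul1r; congr (_ + _).
  rewrite big_add1/= big_mkord mulr_sumr; apply: eq_bigr => k _.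
  by rewrite mulrCA.
rewrite mE SE; have := TX K; have := XT _ K0; rewrite Xt !lee_fin => h1 h2.
rewrite ler_pM2l// lerD2l h2/=.
apply: le_trans (_ : (1 - p%:R^-1) * (dens 0%N + (T K + p%:R ^- K / (1 - p%:R^-1))) <= _).
  by rewrite ler_pM2l// lerD2l.
by rewrite addrA mulrDr lerD2l mulrCA divff ?mulr1// gt_eqF.
Qed.

(** Truncate at k < K: exponents divisible by p^K have proportion at most p^(-K), and the tail of
    [mustar] is at most p^(-K). Finitely many limits from [exact_pow_cvg] remain. *)
Lemma equidistr_mustar (x : laurent F) : equidistr_coprime R p x ->
  unif_distr mustar (fun n : nat => bracket (lpow x n.+1)).
Proof.
move=> xE.
have H r (v : word F r) : (N%:R^-1 * \sum_(n < N)
    (restr r (bracket (lpow x n.+1)) \in [set v]%SET)%:R) @[N --> \oo] --> pr mustar [set v].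
  apply/cvgrPdist_le => e e0.
  have e4 : 0 < e / 4 by rewrite divr_gt0.
  have [K K0 Ke] : exists2 K, (0 < K)%N & p%:R ^- K <= e / 4 :> R.
    (* This [K] satisfies p^K > K > 4/e. *)
    exists (Num.truncn (e / 4)^-1).+1 => //.
    rewrite invf_ple ?posrE ?exprn_gt0//; apply: le_trans (ltW (truncnS_gt _)) _.
    by rewrite -natrX ler_nat ltnW// ltn_expl// prime_gt1.
  pose l k : R := p%:R ^- k * ((1 - p%:R^-1) * density R (stretch_preim p k [set v]%SET)).
  pose A k N : R := N%:R^-1 * \sum_(n < N) (exact_pow p k n.+1 &&
    (restr r (bracket (lpow x n.+1)) \in [set v]%SET))%:R.
  have cA : \sum_(k < K) A k N @[N --> \oo] --> \sum_(k < K) l k.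
    apply: (@cvg_sumr R _ (fun k : 'I_K => A k) (fun k : 'I_K => l k)) => k.
    by have := exact_pow_cvg hp xE; move=> /(_ k r [set v]%SET).
  move/cvgrPdist_le : cA => /(_ _ e4).
  apply: filterS2 (nbhs_infty_gt 0%N) => N N0 HN.
  have N0R : 0 < N%:R :> R by rewrite ltr0n.
  have /andP[ml mu_] := mustar_truncation (x := v) K0 erefl.
  set m := pr mustar _ in ml mu_ *.
  set tot := _ * _.
  have tA : \sum_(k < K) A k N <= tot <= \sum_(k < K) A k N + p%:R ^- K.
    have totE : tot = \sum_(k < K) A k N + N%:R^-1 * \sum_(n < N)
        (p ^ K %| n.+1)%:R * (restr r (bracket (lpow x n.+1)) \in [set v]%SET)%:R.
      rewrite -mulr_sumr -mulrDr exchange_big/= -big_split/=; congr (_ * _).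
      apply: eq_bigr => n _; set b := (_ \in _).
      rewrite -[LHS]mul1r -[X in X * _ = _](exact_pow_decomposition K n.+1) mulrDl; congr (_ + _).
      rewrite mulr_suml; apply: eq_bigr => k _.
      by case: exact_pow; rewrite ?mul1r ?mul0r.
    rewrite totE lerDl lerD2l; apply/andP; split.
      by rewrite mulr_ge0 ?invr_ge0// sumr_ge0.
    have pK0 : (0 < p ^ K)%N by rewrite expn_gt0 p_gt0.
    rewrite ler_pdivrMl//.
    apply: (@le_trans _ _ (\sum_(n < N) (p ^ K %| n.+1)%:R)).
      by apply: ler_sum => n _; case: (_ \in _); rewrite ?mulr1 ?mulr0.
    rewrite sum_dvdn1// -natrX ler_pdivlMr ?ltr0n// -natrM ler_nat.
    exact: leq_trunc_div.
  have /andP[t1 t2] := tA.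
  move: HN; rewrite !ler_norml => /andP[h1 h2].
  have lE : \sum_(k < K) l k = \sum_(k < K) p%:R ^- k *
    ((1 - p%:R^-1) * density R (stretch_preim p k [set v]%SET)) by [].
  rewrite -lE in ml mu_.
  by apply/andP; split; lra.
apply: unif_distr_word => r v.
by have := H r v; rewrite -cvg_shiftS.
Qed.

End Mustar.

(** * Failure of equidistribution for [mu] *)

Lemma pchar_le_card : (p <= q)%N.
Proof.
have := @leq_card _ _ (fun i : 'I_p => i%:R : F); rewrite card_ord; apply.
have H (i j : 'I_p) : (i <= j)%N -> i%:R = j%:R :> F -> i = j.
  move=> ij /eqP; rewrite eq_sym -subr_eq0 -natrB// -(dvdn_pcharf hp) => h.
  apply/val_inj/eqP; rewrite eqn_leq ij/= -subn_eq0; apply/negPn/negP => ji.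
  have := dvdn_leq (ltac:(lia) : (0 < j - i)%N) h.
  by have := ltn_ord j; lia.
move=> i j ij; case: (leqP i j) => h; first exact: H.
by apply/esym/H; [exact: ltnW|].
Qed.

(** Neither 1 nor p + 1 is divisible by p. Two indices are taken because one coefficient vanishes
    with probability 1/q, which is 1/p when q = p. *)
Definition two_zeros : {set word F p.+2} :=
  [set v : word F p.+2 | (v (inord 1) == 0) && (v (inord p.+1) == 0)]%SET.

(** Filling the two zeros with arbitrary values is injective. *)
Lemma card_two_zeros : (#|two_zeros| * (q * q) <= q ^ p.+2)%N.
Proof.
pose bump2 (t : F * F) : word F p.+2 := [ffun i : 'I_p.+2 =>
  if i == 1%N :> nat then t.1 else if i == p.+1 :> nat then t.2 else 0].
pose phi (z : word F p.+2 * (F * F)) := z.1 + bump2 z.2.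
have p1 := prime_gt1 p_pr.
have inj : {in finset.setX two_zeros [set: F * F]%SET &, injective phi}.
  move=> [v [c c']] [v' [d d']]; rewrite !inE/= !andbT.
  move=> /andP[/eqP v1 /eqP v2] /andP[/eqP v1' /eqP v2'] E.
  have i1 : (inord 1 : 'I_p.+2) = 1%N :> nat by rewrite inordK//; lia.
  have i2 : (inord p.+1 : 'I_p.+2) = p.+1 :> nat by rewrite inordK.
  have cd : c = d.
    have := congr1 (fun f : word F p.+2 => f (inord 1)) E.
    by rewrite !ffunE v1 v1' i1/= !add0r.
  have cd' : c' = d'.
    have := congr1 (fun f : word F p.+2 => f (inord p.+1)) E.
    rewrite !ffunE v2 v2' i2 eqxx /= !add0r.
    by case: eqP => //; lia.
  by move: E; rewrite /phi/= cd cd' => /addIr ->.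
rewrite -(card_prod F F) -(cardsT (F * F)%type) -cardsX -(card_in_imset inj).
by rewrite (leq_trans (max_card _))// card_ffun card_ord.
Qed.

(** The multiples n of p, of density 1/p, put [x^n] into the cylinder of [two_zeros], whose measure
    is at most 1/q^2 < 1/p. *)
Lemma not_equidistr_haar (mu : probability (Omes F) R) (x : laurent F) :
  is_haar_on [set: Omes F] mu ->
  ~ unif_distr mu (fun n : nat => bracket (lpow x n.+1)).
Proof.
move=> hmu ud; pose f (y : Otop F) : R := (restr p.+2 y \in two_zeros)%:R.
have cf : continuous f.
  move=> y; apply: (@cvg_near_cst (Otop F) R (f y) f (nbhs (y : Otop F)) (nbhs_filter _)).
  apply: (@filterS _ _ (nbhs_filter _) _ _ _ (nbhs_disk (y : Otop F) p.+2)) => z.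
  by move=> /eq_restr; rewrite /f/= => ->.
have := ud f cf; rewrite (Rintegral_word mu (fun v => (v \in two_zeros)%:R)).
have -> : \sum_v (v \in two_zeros)%:R * pr mu [set v] = pr mu two_zeros.
  rewrite pr_sum [RHS]big_mkcond/=; apply: eq_bigr => v _.
  by case: ifP; rewrite ?mul1r ?mul0r.
move=> fl.
have p1 := prime_gt1 p_pr.
(* For p dividing n, [x^n] is a stretched sequence and vanishes at all indices not divisible by
   p. *)
have low N : (N.+1%:R)^-1 * (N.+1 %/ p)%:R <=
    (N.+1%:R)^-1 * \sum_(i < N.+1) f (bracket (lpow x i.+1)).
  rewrite ler_wpM2l ?invr_ge0// -sum_dvdn1//; apply: ler_sum => n _.
  have [/dvdnP[m nm]|_] := boolP (p %| n.+1)%N; last by rewrite /f.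
  have E : bracket (lpow x n.+1) = stretch p 1 (bracket (lpow x m)).
    by rewrite -bracketF// expn1 nm mulnC.
  rewrite /f E inE !ffunE.
  rewrite !inordK//.
  rewrite /stretch expn1 !ifN ?eqxx//.
    by rewrite -addn1 dvdn_addr// dvdn1; lia.
  by rewrite dvdn1; lia.
have lp : (N.+1%:R^-1 * (N.+1 %/ p)%:R : R) @[N --> \oo] --> (p%:R^-1 : R).
  by have := @cvg_divn_ratio R p p_gt0; rewrite -cvg_shiftS.
have : p%:R^-1 <= pr mu two_zeros.
  by apply: (ler_cvg_to lp fl); apply: nearW.
have q0 : 0 < q%:R :> R by have := q_gt0 R F 1; rewrite expn1.
have : pr mu two_zeros <= (q%:R * q%:R)^-1.
  rewrite (haar_pr hmu) ler_pdivrMr ?q_gt0// ler_pdivlMl ?mulr_gt0//.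
  by rewrite mulrC -!natrM ler_nat card_two_zeros.
move=> /[swap] /le_trans /[apply]; rewrite lef_pV2 ?posrE ?mulr_gt0//.
rewrite -natrM ler_nat leqNgt => /negP; apply.
by have := pchar_le_card; nia.
Qed.

End Main.

Theorem theorem1p4 (R : realType) (F : finFieldType) (p : nat)
  (hp : p \in [pchar F])
  (mu : probability (Omes F) R) (hmu : is_haar_on [set: Omes F] mu)
  (muk : nat -> probability (Omes F) R)
  (hmuk : forall k : nat, (0 < k)%N -> is_haar_on (Sk p k) (muk k))
  (mustar : probability (Omes F) R)
  (hstar : forall (a : nat -> F) (r : nat),
     mustar (disk a r) =
     ((1 - p%:R^-1)%:E *
      (mu (disk a r) +
       \sum_(1 <= k <oo) ((p%:R ^- k)%:E * muk k (disk a r `&` Sk p k))))%E) :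
  (forall x : laurent F, pabs_gt1 x ->
     ~ unif_distr mu (fun n : nat => bracket (lpow x n.+1)))
  /\
  (forall k : nat, (0 < k)%N ->
     forall s : nat -> nat, {homo s : i j / (i < j)%N} ->
     range s = [set n : nat | (p ^ k %| n)%N && ~~ (p ^ k.+1 %| n)%N] ->
     haar_ae mu (fun x : laurent F =>
       pabs_gt1 x -> unif_distr (muk k) (fun j : nat => bracket (lpow x (s j)))))
  /\
  haar_ae mu (fun x : laurent F =>
     pabs_gt1 x -> unif_distr mustar (fun n : nat => bracket (lpow x n.+1))).
Proof.
split; first by move=> x _; exact: (not_equidistr_haar hp).
split.
  move=> k k0 s hs rs m; have := equidistr_coprime_ae hp hmu m.
  apply: filterS => a Ha xa.
  exact: (equidistr_exact_pow hp (Ha xa) hmu (hmuk k k0) hs rs).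
move=> m; have := equidistr_coprime_ae hp hmu m; apply: filterS => a Ha xa.
exact: (equidistr_mustar hp hmu hmuk hstar (Ha xa)).
Qed.
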